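(* Let $G$ be a topological group. Then $G/{\equiv}=G/\overline{\{1\}}$; that is, for all $x,y\in G$, $x\equiv y$ if and only if $x\overline{\{1\}}=y\overline{\{1\}}$.
   Context: A topological group is a group with a topology for which multiplication $G\times G\to G$ and inversion $G\to G$ are continuous (no separation axiom is assumed). Points $x,y$ of a topological space are topologically indistinguishable, $x\equiv y$, if every open set containing $x$ contains $y$ and vice versa; this is an equivalence relation, and $G/{\equiv}$ is the set of its equivalence classes with the quotient topology (the Kolmogorov quotient). $\overline{\{1\}}$ is the closure of the set containing only the identity element $1$; it is a normal subgroup of $G$. For a subgroup $H$ of $G$, $G/H=\{xH\mid x\in G\}$ is the set of left cosets with the quotient topology (a set is open if and only if its preimage under $x\mapsto xH$ is open). *)

(* Defs.v *)
From HB Require Import structures.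
From mathcomp Require Import all_boot.
From mathcomp Require Import boolp classical_sets topology.

Set Implicit Arguments.
Unset Strict Implicit.
Unset Printing Implicit Defensive.

Local Open Scope classical_set_scope.
Local Open Scope group_scope.

HB.mixin Record isTopologicalGroup G of Topological G & Group G := {
  mulg_continuous : continuous (fun xy : G * G => xy.1 * xy.2) ;
  invg_continuous : continuous (fun x : G => x^-1)
}.

#[short(type="topologicalGroupType")]
HB.structure Definition TopologicalGroup :=
  {G of isTopologicalGroup G & Topological G & Group G}.

Definition indistinguishable (T : topologicalType) (x y : T) : Prop :=
  forall U : set T, open U -> (U x <-> U y).

(* A quotient of T is presented by a map block : T -> set T sending each point
   to the block (equivalence class or coset) containing it. The quotient space
   is the pair made of its underlying set, whose elements are subsets of T, and
   of its topology, i.e. the collection of its open subsets. *)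
Definition quotient_space (T : topologicalType) (block : T -> set T) :
    set (set T) * set (set (set T)) :=
  (range block, [set V | V `<=` range block /\ open (block @^-1` V)]).

Definition kolmogorov_quotient (T : topologicalType) :=
  quotient_space (fun x : T => [set y | indistinguishable x y]).

Definition left_coset (G : groupType) (x : G) (H : set G) : set G :=
  [set x * h | h in H].

Definition coset_space (G : topologicalGroupType) (H : set G) :=
  quotient_space (fun x : G => left_coset x H).

(* Main.v *)
Require Import Defs.
From mathcomp Require Import all_boot.
From mathcomp Require Import boolp classical_sets topology.

Local Open Scope classical_set_scope.
Local Open Scope group_scope.

(** The class of [x] under indistinguishability and the coset of [x] modulo the
    closure of [1] are the same subset of [G], so the two quotients have the same
    blocks and hence the same topology. Continuous maps preserve
    indistinguishability, so left translations reduce the equality of blocks to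
    the case [x = 1] ([left_coset_closure1]). There, [z] lies in the closure of
    [1] as soon as every open set containing [z] contains [1]; the homogeneity of
    a topological group makes this one-sided condition symmetric, via the
    map [w |-> w^-1 * z] that exchanges [1] and [z] ([closure1P]). *)

Lemma indistinguishable_sym (T : topologicalType) (x y : T) :
  indistinguishable x y -> indistinguishable y x.
Proof. by move=> xy U oU; have [] := xy U oU; split. Qed.

Lemma indistinguishable_trans (T : topologicalType) (x y z : T) :
  indistinguishable x y -> indistinguishable y z -> indistinguishable x z.
Proof.
by move=> xy yz U oU; have [? ?] := xy U oU; have [? ?] := yz U oU; split; auto.
Qed.

Lemma indistinguishable_continuous (S T : topologicalType) (f : S -> T)
    (x y : S) :
  continuous f -> indistinguishable x y -> indistinguishable (f x) (f y).
Proof. by move=> /continuousP cf xy U oU; exact: xy (cf U oU). Qed.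

Lemma indistinguishable_classP (T : topologicalType) (x y : T) :
  indistinguishable x y <->
  [set z | indistinguishable x z] = [set z | indistinguishable y z].
Proof.
split=> [xy|exy].
  apply/seteqP; split=> z /=; apply: indistinguishable_trans => //.
  exact: indistinguishable_sym.
have : [set z | indistinguishable y z] y by [].
by rewrite -exy.
Qed.

Lemma continuous_mulg2 (T : topologicalType) (G : topologicalGroupType)
    (f g : T -> G) :
  continuous f -> continuous g -> continuous (fun t => f t * g t).
Proof.
move=> cf cg t.
apply: (@continuous_comp _ _ _ (fun t => (f t, g t)) (fun p => p.1 * p.2)).
  exact: cvg_pair (cf t) (cg t).
exact: mulg_continuous.
Qed.

Lemma continuous_mulgl (G : topologicalGroupType) (a : G) :
  continuous (fun x : G => a * x).
Proof. by apply: continuous_mulg2 => x; [exact: cvg_cst|exact: cvg_id]. Qed.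

(** Membership in the closure gives only that open sets around [z] contain [1];
    the converse comes from pulling an open set around [1] back along
    [w |-> w^-1 * z], a continuous map sending [z] to [1] and [1] to [z]. *)
Lemma closure1P (G : topologicalGroupType) (z : G) :
  closure [set (1 : G)] z <-> indistinguishable 1 z.
Proof.
split=> [clz|z1 B].
  have open1 U : open U -> U z -> U 1.
    by move=> oU Uz; have [_ [->]] := clz U (open_nbhs_nbhs (conj oU Uz)).
  move=> U oU; split=> [U1|]; last exact: open1.
  have /continuousP cswap : continuous (fun w : G => w^-1 * z).
    by apply: continuous_mulg2 => w; [exact: invg_continuous|exact: cvg_cst].
  have := open1 _ (cswap U oU).
  by rewrite /preimage /= mulVg invg1 mul1g; apply.
rewrite nbhsE => -[U [oU Uz] UB].
by exists 1; split=> //; apply: UB; apply/(z1 U oU).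
Qed.

Lemma left_coset_closure1 (G : topologicalGroupType) (x : G) :
  left_coset x (closure [set (1 : G)]) = [set y | indistinguishable x y].
Proof.
apply/seteqP; split=> [_ [h /closure1P h1 <-]|y /= xy].
  have := indistinguishable_continuous _ _ _ _ _ (continuous_mulgl G x) h1.
  by rewrite mulg1.
exists (x^-1 * y); last by rewrite mulgA mulgV mul1g.
apply/closure1P.
have := indistinguishable_continuous _ _ _ _ _ (continuous_mulgl G x^-1) xy.
by rewrite mulVg.
Qed.

Theorem theorem6p11 (G : topologicalGroupType) :
  kolmogorov_quotient G = coset_space (closure [set (1 : G)]) /\
  forall x y : G,
    indistinguishable x y <->
    left_coset x (closure [set (1 : G)]) = left_coset y (closure [set (1 : G)]).
Proof.
split=> [|x y]; last by rewrite !left_coset_closure1; exact: indistinguishable_classP.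
rewrite /kolmogorov_quotient /coset_space; congr quotient_space.
by apply/funext => x; rewrite left_coset_closure1.
Qed.
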